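(* Let $\bar g_N:\mathcal{ST}(r,d)\to\mathbb{R}_{\ge0}$ be the $N$-step prediction error over the test data, $$\bar g_N(U)=\frac{1}{2JN}\sum_{i=1}^J\sum_{k=1}^N\big\|x(k,\check x_i)-\hat x(k,\check x_i;S)\big\|_2^2,$$ where $S$ is the subspace represented by $U$. Then, for all $U\in\mathcal{ST}(r,d)$ and all orthogonal matrices $\Theta\in\mathrm{O}(r)$, the equality $\bar g_N(U)=\bar g_N(U\Theta)$ holds.
   Context: Setting: $f:\mathbb{R}^n\to\mathbb{R}^n$ is a map and $X\subseteq\mathbb{R}^n$ is non-empty, compact and forward invariant ($f(X)\subseteq X$). For $x_0\in X$, $x(\cdot,x_0)$ is the trajectory $x(0,x_0)=x_0$, $x(t+1,x_0)=f(x(t,x_0))$. $H$ is the space $L^2(X;\mathbb{R})$ of observables; its elements are treated as everywhere-defined functions $\mathbb{R}^n\to\mathbb{R}$ (square integrable on $X$), with equality and linear operations understood pointwise. Let $\theta_k(x)=x_k$, $k=1,\dots,n$, be the coordinate functions. $V\subset H$ is an $M$-dimensional subspace with basis $B=(\psi_1,\dots,\psi_M)$ such that $\psi_k=\theta_k$ for $k=1,\dots,n$. Training data $(x_i,y_i=f(x_i))\in X\times X$, $i=1,\dots,L$, $L\ge M$, are given; the data matrices $G_B,S_B\in\mathbb{R}^{M\times L}$ have entries $\psi_j(x_i)$ and $\psi_j(y_i)$ in row $j$, column $i$, and $G_B$ is assumed to have full row rank. Let $G_B^\top=\hat Q\hat R$ be the thin QR decomposition ($\hat Q^\top\hat Q=I_M$,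 $\hat R\in\mathbb{R}^{M\times M}$ upper triangular), $P=\hat R^{-\top}$ with entries $p_j^k$ (row $j$, column $k$), and let $E=(\varphi_1,\dots,\varphi_M)$, $\varphi_j=\sum_kp_j^k\psi_k$, be the resulting basis of $V$ with data matrices $G_E=PG_B$, $S_E=PS_B$. Fix $s$ with $n\le s\le M-1$, put $d=M-s$, and fix $r$ with $1\le r<d$. Let $T=\mathrm{span}(\varphi_1,\dots,\varphi_s)$ (which contains all coordinate functions) and let $\alpha_k=\varphi_{s+k}$, $k=1,\dots,d$. The Stiefel manifold is $\mathcal{ST}(r,d)=\{U\in\mathbb{R}^{d\times r}: U^\top U=I_r\}$. A matrix $U\in\mathcal{ST}(r,d)$ with entry $u_j^k$ in row $k$, column $j$ represents the subspace $S=\mathrm{span}(\beta_1,\dots,\beta_r)$, where $\beta_j=\sum_ku_j^k\alpha_k$; put $W=T\oplus S$ with basis $\tilde E=(\varphi_1,\dots,\varphi_s,\beta_1,\dots,\beta_r)=(\omega_1,\dots,\omega_{s+r})$. State prediction on $W$: let $\bar U=\operatorname{blkdiag}(I_s,U)$ and $\hat K(U)=\bar U^\top G_ES_E^\top\bar U$ (the matrix of the EDMD compression on $W$ relative to $\tilde E$). For $x_0\in X$ define $z(0)=(\omega_1(x_0),\dots,\omega_{s+r}(x_0))$ and $z(t+1)=\hat K(U)^\top z(t)$. The coordinate matrix $\Pi_{\tilde E}\in\mathbb{R}^{n\times(s+r)}$ has entry $c_k^j$ in row $k$, column $j$, where $\theta_k=\sum_jc_k^j\omega_j$. The state prediction on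 $W$ from $x_0$ is $\hat x(t,x_0;S)=\Pi_{\tilde E}z(t)$. The prediction horizon $N\in\mathbb{N}$ ($N\ge1$) and test initial states $\check x_1,\dots,\check x_J\in X$ ($J\ge1$) are fixed. *)

(* Defs.v *)
(* MathComp / MathComp-Analysis; R^n is 'cV[R]_n. *)
From HB Require Import structures.
From mathcomp Require Import all_boot all_order all_algebra.
From mathcomp Require Import all_classical all_reals all_analysis.

Set Implicit Arguments.
Unset Strict Implicit.
Unset Printing Implicit Defensive.
Import Order.TTheory GRing.Theory Num.Theory.
Import numFieldNormedType.Exports.

Local Open Scope classical_set_scope.
Local Open Scope ring_scope.

Section lebesgue.
Context (R : realType) (n : nat).

(* A box is given by its lower and upper corners; [None] is the empty box,
   which for n = 0 is not of the form [lo, hi]. *)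
Definition box (b : option ('cV[R]_n * 'cV[R]_n)) : set 'cV[R]_n :=
  if b is Some (lo, hi) then [set x | forall i, lo i 0 <= x i 0 <= hi i 0]
  else set0.

Definition box_volume (b : option ('cV[R]_n * 'cV[R]_n)) : R :=
  if b is Some (lo, hi) then \prod_(i < n) Num.max 0 (hi i 0 - lo i 0) else 0.

Definition lebesgue_outer (A : set 'cV[R]_n) : \bar R :=
  ereal_inf [set (\sum_(k <oo) (box_volume (b k))%:E)%E
            | b in [set b : nat -> option ('cV[R]_n * 'cV[R]_n)
                   | A `<=` \bigcup_k box (b k)]].

Lemma box_volume_ge0 b : 0 <= box_volume b.
Proof.
case: b => [[lo hi]|] //=; apply: prodr_ge0 => i _.
by rewrite le_max lexx.
Qed.

Local Open Scope ereal_scope.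

Lemma lebesgue_outer_ge0 A : 0 <= lebesgue_outer A.
Proof.
apply: le_ereal_inf_tmp => _ [b _ <-].
by apply: nneseries_ge0 => k _ _; rewrite lee_fin box_volume_ge0.
Qed.

Lemma lebesgue_outer0 : lebesgue_outer set0 = 0.
Proof.
apply/eqP; rewrite eq_le lebesgue_outer_ge0 andbT.
apply: ereal_inf_lbound; exists (fun=> None) => //=.
by rewrite eseries0.
Qed.

Lemma le_lebesgue_outer : {homo lebesgue_outer : A B / A `<=` B >-> A <= B}.
Proof.
move=> A B AB; apply/ereal_inf_le_tmp => _ [b Bb <-].
by exists b => //; apply: subset_trans AB Bb.
Qed.

Lemma lebesgue_outer_sigma_subadditive : sigma_subadditive lebesgue_outer.
Proof.
move=> A; have [[i ioo]|] := pselect (exists i, lebesgue_outer (A i) = +oo).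
  rewrite (eseries_pinfty _ _ ioo) ?leey// => k _.
  by rewrite -ltNye (lt_le_trans _ (lebesgue_outer_ge0 _)).
rewrite -forallNE => Aoo.
suff add2e (e : {posnum R}) : lebesgue_outer (\bigcup_n A n) <=
    \sum_(i <oo) lebesgue_outer (A i) + e%:num%:E.
  by apply/lee_addgt0Pr => _/posnumP[].
rewrite (le_trans _ (epsilon_trick _ _ _))//; last first.
  by move=> k; exact: lebesgue_outer_ge0.
pose vol b := (box_volume b)%:E.
have vol0 b : 0 <= vol b by rewrite lee_fin box_volume_ge0.
pose P k (b : nat -> option ('cV[R]_n * 'cV[R]_n)) :=
  A k `<=` \bigcup_j box (b j) /\
  \sum_(j <oo) vol (b j) <= lebesgue_outer (A k) + (e%:num / (2 ^ k.+1)%:R)%:E.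
have [G PG] : {G & forall k, P k (G k)}.
  apply: (@choice _ _ P) => k; rewrite /P /lebesgue_outer.
  set S := (X in ereal_inf X); move infS : (ereal_inf S) => iS.
  case: iS infS => [t St|Soo|Soo].
  - have en1 : (0 < e%:num / (2 ^ k.+1)%:R)%R by [].
    have /(lb_ereal_inf_adherent en1) : ereal_inf S \is a fin_num by rewrite St.
    move=> [x [b Ab volb] xS]; exists b; split => //.
    by rewrite /vol volb -St; exact/ltW.
  - by have := Aoo k; rewrite /lebesgue_outer Soo.
  - suff : lbound S 0 by move/le_ereal_inf_tmp; rewrite Soo.
    by move=> /= _ [b Ab <-]; apply: nneseries_ge0 => j _ _; exact: vol0.
have volG0 x : 0 <= (vol \o uncurry G) x by exact: vol0.
apply: (@le_trans _ _ (\esum_(i in setT) (vol \o uncurry G) i)).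
  apply: ereal_inf_lbound => /=.
  have /card_esym/ppcard_eqP[h] := card_nat2.
  exists (uncurry G \o h).
    move=> t [i _ /(PG i).1[j _ Gt]].
    by exists (h^-1%FUN (i, j)) => //=; rewrite invK ?inE.
  rewrite -(esum_pred_image (vol \o uncurry G) _ xpredT) ?[fun=> _]set_true//.
  by rewrite image_eq.
suff -> : \esum_(i in setT) (vol \o uncurry G) i =
    \sum_(i <oo) \sum_(j <oo) vol (G i j).
  apply: lee_nneseries => k _; last exact: (PG k).2.
  by move=> _; apply: nneseries_ge0 => j _ _; exact: vol0.
pose K : nat -> set (nat * nat) := fun i => [set (i, j) | j in setT].
rewrite (_ : setT = \bigcup_k K k); last first.
  by rewrite predeqE => -[a b]; split => // _; exists a => //; exists b.
rewrite esum_bigcupT /=; last 2 first.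
- apply/trivIsetP => i j _ _ ij.
  rewrite predeqE => -[k m] /=; split => //= -[] [_] _ [<-{k} _].
  by move=> [m' _] [] /esym/eqP; rewrite (negbTE ij).
- by move=> [i j]; exact: vol0.
rewrite -(image_id [set: nat]) -fun_true esum_pred_image//; last first.
  by move=> k _; exact: esum_ge0.
apply: eq_eseriesr => /= j _.
rewrite -(esum_pred_image (vol \o uncurry G) (pair j) predT)//=; last first.
  by move=> ? ? _ _ [].
by congr esum; rewrite predeqE => -[a b]; split; move=> [i _ <-]; exists i.
Qed.

HB.instance Definition _ := isOuterMeasure.Build R 'cV[R]_n lebesgue_outer
  lebesgue_outer0 lebesgue_outer_ge0 le_lebesgue_outer
  lebesgue_outer_sigma_subadditive.

(* R^n with the sigma-algebra of Lebesgue (Caratheodory) measurable sets. *)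
Definition lebesgue_type : Type :=
  caratheodory_type (lebesgue_outer : {outer_measure set 'cV[R]_n -> \bar R}).

Definition lebesgue : {measure set lebesgue_type -> \bar R} :=
  OuterMeasure.sort (lebesgue_outer : {outer_measure set 'cV[R]_n -> \bar R}).

Definition L2 (X : set 'cV[R]_n) : set ('cV[R]_n -> R) :=
  [set psi | (psi \_ X : lebesgue_type -> R) \in Lfun lebesgue 2%:E].

End lebesgue.

Section dynamics.
Context (R : realType) (n : nat).
Implicit Types (f : 'cV[R]_n -> 'cV[R]_n) (X : set 'cV[R]_n).

Definition forward_invariant f X := f @` X `<=` X.

Definition trajectory f (t : nat) (x0 : 'cV[R]_n) : 'cV[R]_n := iter t f x0.

Definition theta (k : 'I_n) : 'cV[R]_n -> R := fun x => x k 0.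

Definition norm2 (v : 'cV[R]_n) : R := Num.sqrt (\sum_(i < n) v i 0 ^+ 2).

End dynamics.

Section observables.
Context (R : realType) (n m : nat).
Implicit Types (psi : 'I_m -> 'cV[R]_n -> R) (V : set ('cV[R]_n -> R)).

Definition lincomb psi (c : 'I_m -> R) : 'cV[R]_n -> R :=
  fun x => \sum_(k < m) c k * psi k x.

Definition is_basis psi V :=
  V = range (lincomb psi) /\
  forall c, lincomb psi c = (fun=> 0) -> forall k, c k = 0.

Definition data_mx (L : nat) psi (pts : 'I_L -> 'cV[R]_n) : 'M[R]_(m, L) :=
  \matrix_(j, i) psi j (pts i).

(* The default value 0 is taken only when the coordinate functions are not all
   in the span of omega; the matrix is unique when omega is independent. *)
Definition coord_mx (omega : 'I_m -> 'cV[R]_n -> R) : 'M[R]_(n, m) :=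
  xget 0 [set C : 'M[R]_(n, m) | forall k, theta k = lincomb omega (C k)].

End observables.

Section stiefel.
Context (R : realType).

Definition thin_qr (L M : nat) (A : 'M[R]_(L, M)) (Q : 'M[R]_(L, M))
    (T : 'M[R]_M) :=
  [/\ A = Q *m T, Q^T *m Q = 1%:M &
      (* [is_trig_mx] means lower triangular *) is_trig_mx T^T].

Definition stiefel (r d : nat) : set 'M[R]_(d, r) :=
  [set U | U^T *m U = 1%:M].

Definition orthogonal_group (r : nat) : set 'M[R]_r :=
  [set Theta | Theta^T *m Theta = 1%:M].

End stiefel.

Arguments stiefel {R} r d.
Arguments orthogonal_group {R} r.

(* The ambient dimension M is s + d: 'I_(s + d) splits into the indices
   [lshift d i] of the fixed part and [rshift s k] of the alpha_k. *)
Section prediction.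
Context (R : realType) (n s d r L : nat).
Variable f : 'cV[R]_n -> 'cV[R]_n.
Variable phi : 'I_(s + d) -> 'cV[R]_n -> R.
Variables GE SE : 'M[R]_(s + d, L).
Variable U : 'M[R]_(d, r).

Definition alpha (k : 'I_d) : 'cV[R]_n -> R := phi (rshift s k).

Definition beta (j : 'I_r) : 'cV[R]_n -> R :=
  lincomb alpha (fun k => U k j).

Definition omega (j : 'I_(s + r)) : 'cV[R]_n -> R :=
  match fintype.split j with
  | inl i => phi (lshift d i)
  | inr i => beta i
  end.

Definition Ubar : 'M[R]_(s + d, s + r) := block_mx 1%:M 0 0 U.

Definition Khat : 'M[R]_(s + r) := Ubar^T *m GE *m SE^T *m Ubar.

Definition lifted_state (t : nat) (x0 : 'cV[R]_n) : 'cV[R]_(s + r) :=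
  iter t (fun z => Khat^T *m z) (\col_j omega j x0).

Definition state_prediction (t : nat) (x0 : 'cV[R]_n) : 'cV[R]_n :=
  coord_mx omega *m lifted_state t x0.

Definition prediction_error (J N : nat) (xtest : 'I_J -> 'cV[R]_n) : R :=
  (2 * J%:R * N%:R)^-1 *
  \sum_(i < J) \sum_(1 <= k < N.+1)
    norm2 (trajectory f k (xtest i) - state_prediction k (xtest i)) ^+ 2.

End prediction.

(* Main.v *)
Require Import Defs.
From HB Require Import structures.
From mathcomp Require Import all_boot all_order all_algebra.
From mathcomp Require Import all_classical all_reals all_analysis.

Set Implicit Arguments.
Unset Strict Implicit.
Unset Printing Implicit Defensive.
Import Order.TTheory GRing.Theory Num.Theory.
Import numFieldNormedType.Exports.

Local Open Scope classical_set_scope.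
Local Open Scope ring_scope.

(** The prediction depends only on the subspace [W], and [U] and [U *m Theta]
    span the same one.  Write [feature_vector psi x] for the column of values at
    [x] of a family [psi] of observables.  With [D] = blkdiag(1, Theta) one has
    [Ubar (U *m Theta) = Ubar U *m D], and [D] is orthogonal.  Hence the basis
    of [W] has its feature vectors multiplied by [D^T]
    ([feature_vector_omega], [UbarM]) and the EDMD matrix is conjugated by [D],
    so that by induction on time every lifted state is multiplied by [D^T].
    The coordinate matrix is multiplied by [D] on the right
    ([coord_mx_change_basis]), so the product of the two, which is the
    prediction, does not change ([state_prediction_rotation]), and neither does
    the error.

    The delicate step is the one on the coordinate matrix: it must
    be determined by the basis of [W], that is, this basis must be linearly
    independent.  Independence passes from the dictionary to the QR basis because
    the triangular factor of a full-rank data matrix is invertible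
    ([thin_qr_unitmx]), and from there to the basis of [W] because the columns
    of [U] are orthonormal ([independent_omega]). *)

Section feature_vectors.
Context (R : realType) (n : nat).

Definition feature_vector (m : nat) (psi : 'I_m -> 'cV[R]_n -> R)
  (x : 'cV[R]_n) : 'cV[R]_m := \col_j psi j x.

Definition independent (m : nat) (psi : 'I_m -> 'cV[R]_n -> R) :=
  forall c, lincomb psi c = (fun=> 0) -> forall k, c k = 0.

Lemma mul_feature_vectorE (m p : nat) (psi : 'I_m -> 'cV[R]_n -> R)
    (C : 'M[R]_(p, m)) (x : 'cV[R]_n) (k : 'I_p) :
  (C *m feature_vector psi x) k 0 = lincomb psi (C k) x.
Proof. by rewrite mxE; apply: eq_bigr => j _; rewrite mxE. Qed.

Lemma feature_vector_lincomb (m p : nat) (psi : 'I_m -> 'cV[R]_n -> R)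
    (C : 'M[R]_(p, m)) (x : 'cV[R]_n) :
  feature_vector (fun j => lincomb psi (C j)) x = C *m feature_vector psi x.
Proof. by apply/colP => k; rewrite mul_feature_vectorE mxE. Qed.

(** Linear independence in matrix form: the feature vectors of an independent
    family can be cancelled on the right, since each row of [C - D] is a
    vanishing linear combination. *)
Lemma independent_mulmx_inj (m p : nat) (psi : 'I_m -> 'cV[R]_n -> R)
    (C D : 'M[R]_(p, m)) :
  independent psi ->
  (forall x, C *m feature_vector psi x = D *m feature_vector psi x) -> C = D.
Proof.
move=> free_psi CD; apply/matrixP => i j; apply/eqP; rewrite -subr_eq0.
have -> : C i j - D i j = (C - D) i j by rewrite !mxE.
apply/eqP; move: j; apply: free_psi; apply/funext => x.
by rewrite -mul_feature_vectorE mulmxBl CD subrr mxE.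
Qed.

Lemma independent_row_free (m p : nat) (psi : 'I_m -> 'cV[R]_n -> R)
    (om : 'I_p -> 'cV[R]_n -> R) (B : 'M[R]_(p, m)) :
  independent psi -> row_free B ->
  (forall x, feature_vector om x = B *m feature_vector psi x) ->
  independent om.
Proof.
move=> free_psi freeB omB c c0 k.
suff /rowP/(_ k) : \row_j c j = 0 by rewrite !mxE.
apply: (row_free_inj freeB); rewrite mul0mx.
apply: (independent_mulmx_inj free_psi) => x.
rewrite -mulmxA -omB mul0mx; apply/colP => i.
rewrite mul_feature_vectorE mxE -[RHS](congr1 (fun h => h x) c0).
by apply: eq_bigr => j _; rewrite mxE.
Qed.

(** Applied to all points at once, the defining equations of the coordinate
    matrix say that it is a left inverse of the feature map. *)
Lemma coord_mx_eq (m : nat) (om : 'I_m -> 'cV[R]_n -> R) (C : 'M[R]_(n, m)) :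
  (forall k, theta k = lincomb om (C k)) <->
  (forall x, C *m feature_vector om x = x).
Proof.
split=> [thetaC x | Cx k].
  by apply/colP => k; rewrite mul_feature_vectorE -thetaC.
by apply/funext => x; rewrite -mul_feature_vectorE Cx.
Qed.

Lemma coord_mx_unique (m : nat) (om : 'I_m -> 'cV[R]_n -> R)
    (C : 'M[R]_(n, m)) :
  independent om -> (forall x, C *m feature_vector om x = x) ->
  coord_mx om = C.
Proof.
move=> free_om Cx; apply: xget_unique; first by apply/coord_mx_eq.
move=> C' /coord_mx_eq C'x; apply: (independent_mulmx_inj free_om) => x.
by rewrite C'x Cx.
Qed.

(** If [C] gives the coordinate functions in terms of [om], then [C *m D] gives
    them in terms of [om'], because [D *m D^T] cancels; independence makes these
    matrices the only choices.  The same cancellation shows that the coordinate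
    functions lie in the span of [om] exactly when they lie in that of [om'], so
    that the default value is taken on both sides or on neither. *)
Lemma coord_mx_change_basis (m : nat) (om om' : 'I_m -> 'cV[R]_n -> R)
    (D : 'M[R]_m) :
  independent om -> D^T *m D = 1%:M ->
  (forall x, feature_vector om' x = D^T *m feature_vector om x) ->
  coord_mx om' = coord_mx om *m D.
Proof.
move=> free_om DtD omD; have DDt := mulmx1C DtD.
have free_om' : independent om'.
  apply: (independent_row_free free_om _ omD).
  by apply/row_freeP; exists D.
have [[C Cx]|noC] :=
  pselect (exists C : 'M[R]_(n, m), forall x, C *m feature_vector om x = x).
  rewrite (coord_mx_unique free_om Cx); apply: coord_mx_unique => // x.
  by rewrite omD mulmxA -(mulmxA C) DDt mulmx1 Cx.
have -> : coord_mx om = 0.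
  by apply: xgetPN => C /coord_mx_eq Cx; apply: noC; exists C.
rewrite mul0mx; apply: xgetPN => C /coord_mx_eq Cx; apply: noC.
by exists (C *m D^T) => x; rewrite -mulmxA -omD Cx.
Qed.

End feature_vectors.

Section rotation.
Context (R : realType) (n s d r L : nat).
Implicit Types (phi : 'I_(s + d) -> 'cV[R]_n -> R) (U : 'M[R]_(d, r)).

Lemma feature_vector_omega phi U x :
  feature_vector (omega phi U) x = (Ubar s U)^T *m feature_vector phi x.
Proof.
apply/colP => j; rewrite !mxE big_split_ord /= /omega.
case: (fintype.splitP j) => i /esym ji.
  have {ji} -> : j = lshift r i by apply/val_inj.
  rewrite [X in _ + X]big1 ?addr0 => [|k _]; last first.
    by rewrite mxE /Ubar block_mxEdl mxE mul0r.
  rewrite (bigD1 i) //= big1 ?addr0 => [|k /negPf ki].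
    by rewrite mxE /Ubar block_mxEul !mxE eqxx mul1r.
  by rewrite mxE /Ubar block_mxEul mxE ki mul0r.
have {ji} -> : j = rshift s i by apply/val_inj.
rewrite big1 ?add0r => [|k _]; last first.
  by rewrite mxE /Ubar block_mxEur mxE mul0r.
by apply: eq_bigr => k _; rewrite mxE /Ubar block_mxEdr mxE.
Qed.

Lemma UbarM U (Theta : 'M[R]_r) :
  Ubar s (U *m Theta) = Ubar s U *m Ubar s Theta.
Proof. by rewrite /Ubar mulmx_block !(mulmx0, mul0mx, mulmx1, addr0, add0r). Qed.

Lemma Ubar_orthonormal (p : nat) (W : 'M[R]_(p, r)) :
  W^T *m W = 1%:M -> (Ubar s W)^T *m Ubar s W = 1%:M.
Proof.
move=> WtW; rewrite /Ubar tr_block_mx !trmx0 trmx1 mulmx_block WtW.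
by rewrite !(mulmx0, mul0mx, mulmx1, addr0, add0r) -scalar_mx_block.
Qed.

(** The right inverse of [(Ubar s U)^T] is what orthonormality of the columns of
    [U] provides: no linear relation is created on passing from [phi] to the
    basis of [W]. *)
Lemma independent_omega phi U :
  independent phi -> stiefel r d U -> independent (omega phi U).
Proof.
move=> free_phi /(Ubar_orthonormal) UtU.
apply: (independent_row_free free_phi) (feature_vector_omega phi U).
by apply/row_freeP; exists (Ubar s U).
Qed.

(** Rotating [U] by [Theta] replaces the basis of [W] by an orthogonally
    equivalent one, with change of basis [D] = blkdiag(1, Theta): the lifted
    states are multiplied by [D^T], the coordinate matrix by [D], and the two
    factors cancel. *)
Lemma state_prediction_rotation phi (GE SE : 'M[R]_(s + d, L)) U
    (Theta : 'M[R]_r) t x0 :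
  independent phi -> stiefel r d U -> orthogonal_group r Theta ->
  state_prediction phi GE SE (U *m Theta) t x0 =
  state_prediction phi GE SE U t x0.
Proof.
move=> free_phi stU /Ubar_orthonormal; set D := Ubar s Theta => DtD.
have DDt : D *m D^T = 1%:M := mulmx1C DtD.
have omD x : feature_vector (omega phi (U *m Theta)) x =
    D^T *m feature_vector (omega phi U) x.
  by rewrite !feature_vector_omega UbarM trmx_mul mulmxA.
have KD : (Khat GE SE (U *m Theta))^T = D^T *m (Khat GE SE U)^T *m D.
  by rewrite /Khat UbarM !trmx_mul !trmxK !mulmxA.
have zD : lifted_state phi GE SE (U *m Theta) t x0 =
    D^T *m lifted_state phi GE SE U t x0.
  elim: t => [|t IHt]; first exact: omD.
  rewrite /lifted_state !iterS -!/(lifted_state _ _ _ _ _ _) IHt KD.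
  by rewrite -[_ *m D *m _]mulmxA [D *m _]mulmxA DDt mul1mx mulmxA.
rewrite /state_prediction zD.
rewrite (coord_mx_change_basis (independent_omega free_phi stU) DtD omD).
by rewrite -mulmxA [D *m _]mulmxA DDt mul1mx.
Qed.

End rotation.

(** [A^T = T^T *m Q^T] bounds the rank of [A^T], which is maximal, by that of
    [T]. *)
Lemma thin_qr_unitmx (R : realType) (L M : nat) (A Q : 'M[R]_(L, M))
    (T : 'M[R]_M) :
  row_free A^T -> thin_qr A Q T -> T \in unitmx.
Proof.
move=> freeA [AQT _ _]; rewrite -unitmx_tr -row_free_unit /row_free eqn_leq.
rewrite rank_leq_row -[leqLHS](eqP freeA) AQT trmx_mul.
exact: mxrankM_maxl.
Qed.

Theorem proposition7 (R : realType) (n s d r L J N : nat)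
  (f : 'cV[R]_n -> 'cV[R]_n) (X : set 'cV[R]_n)
  (V : set ('cV[R]_n -> R)) (psi : 'I_(s + d) -> 'cV[R]_n -> R)
  (x : 'I_L -> 'cV[R]_n)
  (Qhat : 'M[R]_(L, s + d)) (Rhat : 'M[R]_(s + d))
  (xtest : 'I_J -> 'cV[R]_n)
  (X_nonempty : X !=set0)
  (X_compact : compact X)
  (X_invariant : forward_invariant f X)
  (n_le_s : (n <= s)%N)
  (r_ge1 : (1 <= r)%N)
  (r_lt_d : (r < d)%N)
  (M_le_L : (s + d <= L)%N)
  (J_ge1 : (1 <= J)%N)
  (N_ge1 : (1 <= N)%N)
  (V_L2 : V `<=` L2 X)
  (psi_basis : is_basis psi V)
  (psi_theta : forall (k : 'I_n) (j : 'I_(s + d)), j = k :> nat -> psi j = theta k)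
  (x_in_X : forall i, X (x i))
  (GB_full_row_rank : row_free (data_mx psi x))
  (QR : thin_qr (data_mx psi x)^T Qhat Rhat)
  (xtest_in_X : forall i, X (xtest i)) :
  let GB := data_mx psi x in
  let SB := data_mx psi (fun i => f (x i)) in
  let P : 'M[R]_(s + d) := invmx Rhat^T in
  let phi := fun j => lincomb psi (P j) in
  let gN := fun U : 'M[R]_(d, r) =>
    prediction_error f phi (P *m GB) (P *m SB) U N xtest in
  forall (U : 'M[R]_(d, r)) (Theta : 'M[R]_r),
    stiefel r d U -> orthogonal_group r Theta ->
    gN U = gN (U *m Theta).
Proof.
move=> GB SB P phi gN U Theta stU orthT.
have free_phi : independent phi.
  apply: (independent_row_free psi_basis.2 _ (feature_vector_lincomb psi P)).
  rewrite row_free_unit unitmx_inv unitmx_tr.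
  by apply: thin_qr_unitmx QR; rewrite trmxK.
rewrite /gN /prediction_error; congr (_ * _).
apply: eq_bigr => i _; apply: eq_bigr => k _.
by rewrite state_prediction_rotation.
Qed.
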